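(* For any $\vec k_1,\vec k_2\in\mathcal G_{VV}$, with $\vec k_\ell=(k_1^\ell,\dots,k_{m+n}^\ell)$, $\ell=1,2$, there holds $$\Delta(\vec k_1,\vec k_2):=\sum_{i=1}^{m}q_i(k_i^1,k_i^2)-\sum_{j=m+1}^{m+n}q_j(k_j^1,k_j^2)\ge0.$$
   Context: $m,n\ge1$ are integers, $R>0$; indices $i\in\{1,\dots,m\}$, $j\in\{m+1,\dots,m+n\}$, $h\in\{1,\dots,m+n\}$. For each $h$, the flux $f_h:[0,R]\to[0,+\infty)$ satisfies: (F) $f_h$ is Lipschitz with $\|f_h'\|_\infty\le L_h$, $f_h(0)=f_h(R)=0$, and there exists $\bar\rho_h\in(0,R)$ such that $f_h'(\rho)(\bar\rho_h-\rho)>0$ for a.e. $\rho\in[0,R]$; (NLD) $f_h'$ is not constant on any non-trivial subinterval of $[0,R]$. Godunov flux: $G_h(a,b)=\min_{s\in[a,b]}f_h(s)$ if $a\le b$ and $G_h(a,b)=\max_{s\in[b,a]}f_h(s)$ if $a\ge b$, for $a,b\in[0,R]$. Kruzhkov entropy flux: $q_h(u,v)=\mathrm{sign}(u-v)(f_h(u)-f_h(v))$ for $u,v\in[0,R]$, with $\mathrm{sign}(0)=0$. Vanishing viscosity germ: $\mathcal G_{VV}$ is the set of $\vec u=(u_1,\dots,u_{m+n})\in[0,R]^{m+n}$ for which there exists $p\in[0,R]$ such that $\sum_{i=1}^mG_i(u_i,p)=\sum_{j=m+1}^{m+n}G_j(p,u_j)$, $G_i(u_i,p)=f_i(u_i)$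 for all $i$, and $G_j(p,u_j)=f_j(u_j)$ for all $j$. *)

(* Defs.v *)
From HB Require Import structures.
From mathcomp Require Import all_boot all_order all_algebra.
From mathcomp Require Import all_classical all_reals all_analysis.

Set Implicit Arguments.
Unset Strict Implicit.
Unset Printing Implicit Defensive.

Import Order.TTheory GRing.Theory Num.Theory.
Import numFieldNormedType.Exports.

Local Open Scope classical_set_scope.
Local Open Scope ring_scope.

(* A flux on [0, R] is a total function K -> K; every condition below depends
   only on its values on [0, R].  In particular derivatives are only
   constrained almost everywhere, so the endpoints 0 and R, where derive1 f would
   see values outside [0, R], do not matter. *)

(* Condition (F).  Since derive1 f is a total operator, the existence of the
   derivative at almost every point, implicit in "f'(x) (rho - x) > 0 a.e.", is
   spelled out; it is automatic for Lipschitz functions. *)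
Record fluxF (K : realType) (R L : K) (f : K -> K) : Prop := FluxF {
  fluxF_ge0 : forall x, x \in `[0, R] -> 0 <= f x;
  fluxF_lipschitz : [lipschitz f x | x in `[0, R]];
  fluxF_Linfty :
    ('N[@lebesgue_measure K]_(+oo)[
        (fun x : K => (derive1 f x * \1_(`[0%R, R]) x)%:E)] <= L%:E)%E;
  fluxF_left : f 0 = 0;
  fluxF_right : f R = 0;
  fluxF_unimodal : exists2 rho : K, rho \in `]0, R[ &
    {ae @lebesgue_measure K, forall x, x \in `[0, R] ->
       derivable f x 1 /\ 0 < derive1 f x * (rho - x)} }.

(* Condition (NLD): f', as an almost everywhere defined function, is not
   constant on any non-trivial subinterval. *)
Definition fluxNLD (K : realType) (R : K) (f : K -> K) : Prop :=
  forall a b : K, 0 <= a -> a < b -> b <= R ->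
    ~ exists c : K, {ae @lebesgue_measure K, forall x, x \in `[a, b] ->
        is_derive x 1 f c}.

(* inf and sup are attained for continuous f, see godunov_min and godunov_max. *)
Definition godunov (K : realType) (f : K -> K) (a b : K) : K :=
  if a <= b then inf (f @` `[a, b]) else sup (f @` `[b, a]).

Definition kruzhkov (K : realType) (f : K -> K) (u v : K) : K :=
  Num.sg (u - v) * (f u - f v).

(* Roads 1..m (incoming) and m+1..m+n (outgoing) are lshift n i, i : 'I_m, and
   rshift m j, j : 'I_n. *)
Definition germVV (K : realType) (R : K) (m n : nat)
    (f : 'I_(m + n) -> K -> K) : set ('I_(m + n) -> K) :=
  [set u | (forall h, u h \in `[0, R]) /\
    exists p : K, [/\ p \in `[0, R],
      \sum_(i < m) godunov (f (lshift n i)) (u (lshift n i)) p =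
      \sum_(j < n) godunov (f (rshift m j)) p (u (rshift m j)),
      forall i : 'I_m, godunov (f (lshift n i)) (u (lshift n i)) p =
                       f (lshift n i) (u (lshift n i)) &
      forall j : 'I_n, godunov (f (rshift m j)) p (u (rshift m j)) =
                       f (rshift m j) (u (rshift m j))]].

Lemma godunov_min (K : realType) (f : K -> K) (a b : K) :
  a <= b -> {within `[a, b], continuous f} ->
  exists2 s, s \in `[a, b] &
    godunov f a b = f s /\ forall t, t \in `[a, b] -> f s <= f t.
Proof.
move=> ab cf; have [s sab smin] := EVT_min ab cf.
exists s => //; split=> //; rewrite /godunov ab; apply/eqP.
rewrite eq_le; apply/andP; split.
  apply: ge_inf; last by exists s.
  by exists (f s) => _ [t tab <-]; apply: smin.
apply: lb_le_inf; first by exists (f s), s.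
by move=> _ [t tab <-]; apply: smin.
Qed.

Lemma godunov_max (K : realType) (f : K -> K) (a b : K) :
  b <= a -> {within `[b, a], continuous f} ->
  exists2 s, s \in `[b, a] &
    godunov f a b = f s /\ forall t, t \in `[b, a] -> f t <= f s.
Proof.
move=> ba cf; have [s sab smax] := EVT_max ba cf.
exists s => //; split=> //; rewrite /godunov; case: ifPn => [ab|_].
  have eab : a = b by apply/eqP; rewrite eq_le ab ba.
  subst b; rewrite set_itv1 image_set1 inf1.
  by move: sab; rewrite itvxx inE => /eqP ->.
apply/eqP; rewrite eq_le; apply/andP; split.
  apply: ge_sup; first by exists (f s), s.
  by move=> _ [t tab <-]; apply: smax.
apply: ub_le_sup; last by exists s.
by exists (f s) => _ [t tab <-]; apply: smax.
Qed.

(* Main.v *)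
Require Import Defs.
From mathcomp Require Import all_boot all_order all_algebra.
From mathcomp Require Import all_classical all_reals all_analysis.

Set Implicit Arguments.
Unset Strict Implicit.
Unset Printing Implicit Defensive.

Import Order.TTheory GRing.Theory Num.Theory.
Import numFieldNormedType.Exports.

Local Open Scope classical_set_scope.
Local Open Scope ring_scope.

(** The entropy flux is compared with the plain difference of fluxes:
    [q(u, v)] and [f(u) - f(v)] differ only when [u < v], and then by a sign.
    So [q(u, v) >= f(u) - f(v)] as soon as [u <= v] forces [f(u) <= f(v)], and
    [q(u, v) <= f(u) - f(v)] as soon as [u <= v] forces [f(v) <= f(u)].
    Let [p1] and [p2] be junction values certifying that [k1] and [k2] lie in
    the germ; as [q] is symmetric ([kruzhkovC]), one may assume [p2 <= p1].  The
    Godunov flux is nondecreasing in its first argument and nonincreasing in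
    its second ([godunov_homo]), and germ membership makes [f_h (k_h)] a Godunov
    flux across the junction.  Hence [kruzhkov_ge] applies on each incoming
    road: when [k1_i <= k2_i], passing from [k2] to [k1] lowers the left state
    and raises the right one.  Likewise [kruzhkov_le] applies on each outgoing
    road: when [k1_j <= k2_j], passing from [k2] to [k1] raises the left state
    and lowers the right one.  Summing, the entropy balance is at least the
    difference of the mass balances of [k1] and [k2] at the junction, and both
    vanish. *)

Section Junction.
Variable K : realType.
Implicit Types (f : K -> K) (R a b u v : K).

Lemma lipschitz_within_continuous (A : set K) f :
  [lipschitz f x | x in A] -> {within A, continuous f}.
Proof.
move=> lipf; apply/subspace_continuousP => x Ax.
have [M [M0 fM]] : exists M, 0 < M /\ M.-lipschitz_A f.
  have [M [_ fM]] := lipf.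
  by exists (`|M| + 1); split; [|apply: fM; rewrite (le_lt_trans (ler_norm M))];
    rewrite ?ltrDl// ltr_wpDl.
apply/cvgrPdist_le => e e0; apply/nbhs_ballP; exists (e / M).
  by rewrite /= divr_gt0.
move=> y /=; rewrite -ball_normE /= => xye Ay.
apply: le_trans (fM (x, y) _) _; first by split.
by rewrite /= mulrC -ler_pdivlMr// ltW.
Qed.

(** Moving [a] up and [b] down shrinks the interval of the minimum when it
    stays nonempty, enlarges the interval of the maximum when it already is
    one, and otherwise turns a minimum into a maximum over an interval that
    meets the first one. *)
Lemma godunov_homo R f a a' b b' : {within `[0, R], continuous f} ->
  a \in `[0, R] -> a' \in `[0, R] -> b \in `[0, R] -> b' \in `[0, R] ->
  a <= a' -> b' <= b -> godunov f a b <= godunov f a' b'.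
Proof.
move=> cf; rewrite !in_itv /= => /andP[a0 aR] /andP[a'0 a'R] /andP[b0 bR].
move=> /andP[b'0 b'R] aa' bb'.
have cfW x y : 0 <= x -> y <= R -> {within `[x, y], continuous f}.
  move=> x0 yR; apply: continuous_subspaceW cf => z /=.
  rewrite !in_itv /= => /andP[xz zy].
  by rewrite (le_trans x0 xz) (le_trans zy yR).
have [ab|/ltW ba] := leP a b.
  have [s _ [-> smin]] := godunov_min ab (cfW _ _ a0 bR).
  have [ab'|/ltW ba'] := leP a' b'.
    have [t + [-> _]] := godunov_min ab' (cfW _ _ a'0 b'R).
    rewrite in_itv /= => /andP[a't tb']; apply: smin.
    by rewrite in_itv /= (le_trans aa' a't) (le_trans tb' bb').
  have [t _ [-> tmax]] := godunov_max ba' (cfW _ _ b'0 a'R).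
  (* [max a b'] lies both in [[a, b]] and in [[b', a']]. *)
  apply: (@le_trans _ _ (f (Num.max a b'))).
    by apply: smin; rewrite in_itv /= le_max lexx ge_max ab bb'.
  by apply: tmax; rewrite in_itv /= le_max lexx orbT ge_max aa' ba'.
have [s + [-> _]] := godunov_max ba (cfW _ _ b0 aR).
rewrite in_itv /= => /andP[bs sa].
have ba' : b' <= a' by rewrite (le_trans bb') // (le_trans ba).
have [t _ [-> tmax]] := godunov_max ba' (cfW _ _ b'0 a'R).
by apply: tmax; rewrite in_itv /= (le_trans bb' bs) (le_trans sa aa').
Qed.

Lemma kruzhkovC f u v : kruzhkov f u v = kruzhkov f v u.
Proof. by rewrite /kruzhkov -(opprB v u) -(opprB (f v)) sgrN mulrNN. Qed.

(** When [u <= v], the sign is at most [0] while [f u - f v] is nonpositive;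
    when [u > v], the two sides agree. *)
Lemma kruzhkov_ge f u v :
  (u <= v -> f u <= f v) -> f u - f v <= kruzhkov f u v.
Proof.
move=> fuv; rewrite /kruzhkov; case: sgrP; rewrite ?subr_lt0 => uv.
- by move/subr0_eq: uv => ->; rewrite subrr mulr0.
- by rewrite mul1r.
- have := fuv (ltW uv); rewrite mulN1r -subr_le0 => fuv0.
  by rewrite (le_trans fuv0)// oppr_ge0.
Qed.

Lemma kruzhkov_le f u v :
  (u <= v -> f v <= f u) -> kruzhkov f u v <= f u - f v.
Proof.
have := @kruzhkov_ge (fun x => - f x) u v.
rewrite /kruzhkov -opprD mulrN !lerN2.
by move=> kruzhkovN /kruzhkovN.
Qed.

End Junction.

Theorem lemma2p5 (K : realType) (m n : nat) (R : K)
    (L : 'I_(m + n) -> K) (f : 'I_(m + n) -> K -> K)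
    (hm : (1 <= m)%N) (hn : (1 <= n)%N) (hR : 0 < R)
    (hF : forall h, fluxF R (L h) (f h))
    (hNLD : forall h, fluxNLD R (f h))
    (k1 k2 : 'I_(m + n) -> K)
    (hk1 : germVV R f k1) (hk2 : germVV R f k2) :
  0 <= \sum_(i < m) kruzhkov (f (lshift n i)) (k1 (lshift n i)) (k2 (lshift n i))
       - \sum_(j < n) kruzhkov (f (rshift m j)) (k1 (rshift m j)) (k2 (rshift m j)).
Proof.
have cf h : {within `[0, R], continuous (f h)}.
  exact/lipschitz_within_continuous/(fluxF_lipschitz (hF h)).
case: hk1 hk2 => k1R [p1 [p1R bal1 in1 out1]] [k2R [p2 [p2R bal2 in2 out2]]].
wlog p21 : k1 k2 k1R k2R p1 p2 p1R p2R bal1 in1 out1 bal2 in2 out2 / p2 <= p1.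
  move=> wlog_p21; have [|/ltW] := leP p2 p1.
    exact: wlog_p21 bal1 in1 out1 bal2 in2 out2.
  move/(wlog_p21 k2 k1 k2R k1R p2 p1 p2R p1R bal2 in2 out2 bal1 in1 out1).
  by under eq_bigr do rewrite kruzhkovC;
     under [X in _ - X]eq_bigr do rewrite kruzhkovC.
have mass0 :
    \sum_(i < m) (f (lshift n i) (k1 (lshift n i)) -
                  f (lshift n i) (k2 (lshift n i))) =
    \sum_(j < n) (f (rshift m j) (k1 (rshift m j)) -
                  f (rshift m j) (k2 (rshift m j))).
  rewrite !sumrB; under eq_bigr do rewrite -in1.
  under [X in _ - X = _]eq_bigr do rewrite -in2.
  under [X in _ = X - _]eq_bigr do rewrite -out1.
  under [X in _ = _ - X]eq_bigr do rewrite -out2.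
  by rewrite bal1 bal2.
rewrite subr_ge0.
apply: le_trans (_ : _ <= \sum_(j < n) (f (rshift m j) (k1 (rshift m j)) -
                  f (rshift m j) (k2 (rshift m j)))) _.
  apply: ler_sum => j _; apply: kruzhkov_le => k12.
  by rewrite -out1 -out2; apply: (godunov_homo (cf _)).
rewrite -mass0; apply: ler_sum => i _; apply: kruzhkov_ge => k12.
by rewrite -in1 -in2; apply: (godunov_homo (cf _)).
Qed.
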